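(* Let $P$ be the marginal Metropolis--Hastings kernel with target $\pi$, proposal $q$ and acceptance ratio $r$, and let $\tilde P$ be the associated pseudo-marginal kernel with weight distributions $\{Q_x\}_{x\in\mathsf X}$. Suppose that $$\alpha_0:=\inf_{x\in\mathsf X}\int q(x,\mathrm dy)\min\{1,r(x,y)\}>0,$$ and that for some $\beta>1$ $$M_W:=\sup_{x\in\mathsf X}\int(w^\beta+1)Q_x(\mathrm dw)<\infty.$$ Then there exist constants $\delta>0$ and $\bar w\in(1,\infty)$ such that the pseudo-marginal kernel satisfies, for all $x\in\mathsf X$ and $w\in\mathsf W$, $w>0$, the drift condition $$\tilde PV(x,w)\le V(w)-\delta V^{(\beta-1)/\beta}(w)+b_V\mathbb I\{w\in(0,\bar w)\},$$ where $V(x,w):=V(w):=w^\beta+1$ and $b_V:=M_W+\delta V^{(\beta-1)/\beta}(\bar w)$.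
   Context: Let $(\mathsf X,\mathcal B(\mathsf X))$ be a measurable space, $\pi$ a probability measure on it and $q(x,\mathrm dy)$ a Markov kernel on $\mathsf X$. The function $r(x,y)=\frac{\pi(\mathrm dy)q(y,\mathrm dx)}{\pi(\mathrm dx)q(x,\mathrm dy)}$ is the Radon--Nikodym derivative in the sense of Tierney: there is a symmetric measurable set $R\subset\mathsf X^2$ on which the measures $\pi(\mathrm dx)q(x,\mathrm dy)$ and $\pi(\mathrm dy)q(y,\mathrm dx)$ are mutually absolutely continuous, and on whose complement they are mutually singular; on $R$, $r$ is the density of the second with respect to the first, with values in $(0,\infty)$ and $r(x,y)r(y,x)=1$; off $R$, $r:=0$. The marginal kernel is $P(x,\mathrm dy)=\min\{1,r(x,y)\}q(x,\mathrm dy)+\delta_x(\mathrm dy)\rho(x)$ with $\rho(x)=1-\int\min\{1,r(x,y)\}q(x,\mathrm dy)$. Let $\mathsf W$ be a Borel subset of $\mathbb R_+=[0,\infty)$ and let $x\mapsto Q_x$ be a probability kernel from $\mathsf X$ to $\mathsf W$ with $\int w\,Q_x(\mathrm dw)=1$ for all $x$. The pseudo-marginal kernel is $\tilde P(x,w;\mathrm dy,\mathrm du)=\min\{1,r(x,y)\frac uw\}q(x,\mathrm dy)Q_y(\mathrm du)+\delta_{x,w}(\mathrm dy,\mathrm du)\tilde\rho(x,w)$ with $\tilde\rho(x,w)=1-\iint\min\{1,r(x,y)\frac uw\}q(x,\mathrm dy)Q_y(\mathrm du)$, and $\tilde PV(x,w)=\int\tilde P(x,w;\mathrm dy,\mathrm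 du)V(y,u)$. $V^{s}(w)$ means $(V(w))^s$. *)

(* Defs.v *)
From HB Require Import structures.
From mathcomp Require Import all_boot all_order all_algebra.
From mathcomp Require Import all_classical all_reals all_analysis.

Set Implicit Arguments.
Unset Strict Implicit.
Unset Printing Implicit Defensive.

Import Order.TTheory GRing.Theory Num.Theory.
Import numFieldNormedType.Exports.

Local Open Scope classical_set_scope.
Local Open Scope ring_scope.
Local Open Scope ereal_scope.

Section metropolis_hastings.
Context d (X : measurableType d) (R : realType).
Variables (pi : probability X R) (q : R.-pker X ~> X).

(** The measure pi(dx) q(x,dy). *)
Definition mh_joint (A : set (X * X)) : \bar R :=
  \int[pi]_x q x (xsection A x).

Definition pair_flip (z : X * X) : X * X := (z.2, z.1).

(** The measure pi(dy) q(y,dx). *)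
Definition mh_joint_flip : set (X * X) -> \bar R :=
  pushforward mh_joint pair_flip.

(** Mutual singularity of two measures restricted to the set [D]. *)
Definition mutually_singular_on (mu nu : set (X * X) -> \bar R)
    (D : set (X * X)) : Prop :=
  exists N : set (X * X),
    [/\ measurable N, N `<=` D, mu N = 0 & nu (D `\` N) = 0].

(** [r] is a version, in the sense of Tierney, of the Radon-Nikodym derivative
    of pi(dy) q(y,dx) with respect to pi(dx) q(x,dy). *)
Definition mh_ratio (r : X * X -> R) : Prop :=
  measurable_fun [set: X * X] r /\
  exists (S : set (X * X)) (mS : measurable S),
  [/\ pair_flip @^-1` S = S,
      mrestr mh_joint mS `<< mrestr mh_joint_flip mS /\
        mrestr mh_joint_flip mS `<< mrestr mh_joint mS,
      mutually_singular_on mh_joint mh_joint_flip (~` S),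
      (forall A, measurable A -> A `<=` S ->
        mh_joint_flip A = \int[mh_joint]_(z in A) (r z)%:E) &
      (forall x y, S (x, y) ->
        (0 < r (x, y))%R /\ (r (x, y) * r (y, x) = 1)%R) /\
      (forall x y, ~ S (x, y) -> r (x, y) = 0%R)].

(** Probability that the marginal chain accepts a proposal made from [x],
    i.e. 1 - rho(x). *)
Definition mh_acceptance (r : X * X -> R) (x : X) : \bar R :=
  \int[q x]_y (Num.min 1 (r (x, y)))%R%:E.

End metropolis_hastings.

Section pseudo_marginal.
Context d (X : measurableType d) (R : realType).
Variables (q : R.-pker X ~> X) (r : X * X -> R) (Q : R.-pker X ~> R).

(** The weight laws [Q x] are probabilities on the real line carried by the
    weight space, so states are pairs in X * R. Only states with a positive
    weight are meaningful as starting points ([u / 0] is [0]). *)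
Definition pm_accept (z z' : X * R) : R :=
  (Num.min 1 (r (z.1, z'.1) * (z'.2 / z.2)))%R.

Definition pm_rejection (z : X * R) : \bar R :=
  1 - \int[q z.1]_y \int[Q y]_u (pm_accept z (y, u))%:E.

(** The measure A |-> P~(z; A). *)
Definition pm_kernel (z : X * R) (A : set (X * R)) : \bar R :=
  \int[q z.1]_y \int[Q y]_u (pm_accept z (y, u) * \1_A (y, u))%R%:E
  + \d_z A * pm_rejection z.

End pseudo_marginal.

Section drift.
Context d (X : measurableType d) (R : realType).
Variable beta : R.

Definition drift_fun (w : R) : R := (w `^ beta + 1)%R.

Definition weight_moment_bound (Q : R.-pker X ~> R) : \bar R :=
  ereal_sup [set \int[Q x]_w (drift_fun w)%:E | x in [set: X]].

End drift.

(* Main.v *)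
Require Import Defs.
From mathcomp Require Import all_boot all_order all_algebra.
From mathcomp Require Import all_classical all_reals all_analysis.
From mathcomp Require Import measurable_realfun ring lra.

Import Order.TTheory GRing.Theory Num.Theory.
Import numFieldNormedType.Exports.
Import HBNNSimple.

(** Fix [x] and [w > 0], and let [a (y, u)] be the probability of accepting the
    proposal [(y, u)]. Writing [J phi] for the integral of [phi] under
    q(x,dy) Q_y(du), the chain moves with density [a] and otherwise stays put,
    so that the drift function has one-step expectation
        J (a V) + V(w) (1 - J a).
    The first term is at most the moment bound [M], because [a <= 1]. The whole
    question is therefore how often the chain leaves [w], and the claim is that
    [J a] is at least [alpha / (2 w)] for large [w], where [alpha] is a positive
    lower bound on the acceptance probability of the marginal chain.

    Two facts give this. Since [min 1 (s t) >= min 1 s * min 1 t] for [s, t >= 0],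
    the integral factorises through the marginal acceptance probability
    ([two_step_accept_ge]), leaving the mean of [min 1 (u / w)] under [Q_y]. The
    weights have mean one and their [beta]-moments are at most [M], hence the
    part of the mean carried by [u > w] is at most [M / w ^ (beta - 1)], which is
    at most 1/2 once [w] is large, so that [min 1 (u / w)] has mean at least
    [1 / (2 w)] ([integral_min_weight_ge]).

    Consequently for large [w] the expected change of [V] is at most
    [M - alpha / 2 * w ^ (beta - 1)], and [V ^ ((beta - 1) / beta)] is at most
    twice [w ^ (beta - 1)]: any [delta] up to [alpha / 8] works as soon as
    [w ^ (beta - 1) >= 4 M / alpha] ([drift_far]). For smaller [w] the
    additive constant pays for everything ([drift_near]).

    The formula for the one-step expectation has to be proved for the
    pseudo-marginal kernel as a bare set function; the inequality [<=], which is
    all that the drift condition needs, is obtained from simple functions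
    ([integral_accept_reject]). *)

Local Open Scope classical_set_scope.
Local Open Scope ring_scope.
Local Open Scope ereal_scope.

Set Implicit Arguments.
Unset Strict Implicit.

(** * Integrals against a set function that moves or stays *)

(** The integral is a supremum over simple functions minus a supremum that the
    zero function keeps nonnegative. Hence bounding the simple integrals is
    enough, without additivity of [mu]. *)
Lemma ge0_integral_le_sintegral (d : measure_display) (T : measurableType d)
    (R : realType) (mu : set T -> \bar R) (f : T -> \bar R) (B : \bar R) :
  mu set0 = 0 -> (forall x, 0 <= f x) ->
  (forall h : {nnsfun T >-> R}, (forall x, (h x)%:E <= f x) ->
    sintegral mu h <= B) ->
  \int[mu]_x f x <= B.
Proof.
move=> mu0 f0 hB; rewrite /integral patch_setT.
have -> : f ^\+ = f.
  by apply/funext => x; rewrite (ge0_funeposE (D := setT)) ?inE.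
apply: (@le_trans _ _ (ereal_sup [set sintegral mu h |
    h in [set h : {nnsfun T >-> R} | forall x, (h x)%:E <= f x]])); last first.
  by apply: ge_ereal_sup => _ [h /= hf <-]; exact: hB.
rewrite -[leRHS]sube0; apply: leeB => //.
apply: le_ereal_sup_tmp; exists (sintegral mu (nnsfun0 : {nnsfun T >-> R})).
  by exists nnsfun0 => //= x; exact: funeneg_ge0.
rewrite sintegralET fsbig1// => t _.
have [->|t0] := eqVneq t 0%R; first by rewrite mul0e.
rewrite (_ : _ @^-1` _ = set0) ?mu0 ?mule0//.
by apply/seteqP; split => // x /= tx; rewrite -tx eqxx in t0.
Qed.

Section two_step.
Context (d d' : measure_display) (X : measurableType d) (Y : measurableType d')
  (R : realType) (q : R.-pker X ~> X) (Q : R.-pker X ~> Y).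

Definition two_step_integral (x : X) (phi : X * Y -> R) : \bar R :=
  \int[q x]_y \int[Q y]_u (phi (y, u))%:E.

(** Measurability in the intermediate point [y] is what makes the outer integral
    of [two_step_integral] linear and monotone. *)
Lemma measurable_weight_integral (phi : X * Y -> R) :
  (forall z, (0 <= phi z)%R) -> measurable_fun [set: X * Y] phi ->
  measurable_fun [set: X] (fun y => \int[Q y]_u (phi (y, u))%:E).
Proof.
move=> phi0 mphi.
apply: (measurable_fun_integral_finite_kernel (fun z => (phi z)%:E)) => //.
exact/measurable_EFinP.
Qed.

Lemma measurable_section (phi : X * Y -> R) (y : X) :
  measurable_fun [set: X * Y] phi ->
  measurable_fun [set: Y] (fun u => (phi (y, u))%:E).
Proof.
by move=> mphi; apply/measurable_EFinP/(measurableT_comp mphi)/pair1_measurable.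
Qed.

Lemma two_step_integral_ge0 x (phi : X * Y -> R) :
  (forall z, (0 <= phi z)%R) -> 0 <= two_step_integral x phi.
Proof.
by move=> phi0; apply: integral_ge0 => y _; apply: integral_ge0 => u _;
  rewrite lee_fin.
Qed.

Lemma le_two_step_integral x (phi psi : X * Y -> R) :
  measurable_fun [set: X * Y] phi -> measurable_fun [set: X * Y] psi ->
  (forall z, (0 <= phi z <= psi z)%R) ->
  two_step_integral x phi <= two_step_integral x psi.
Proof.
move=> mphi mpsi phipsi.
have phi0 z : (0 <= phi z)%R by case/andP: (phipsi z).
have le_phi z : (phi z <= psi z)%R by case/andP: (phipsi z).
have psi0 z : (0 <= psi z)%R by exact: le_trans (le_phi z).
apply: ge0_le_integral => //.
- by move=> y _; apply: integral_ge0 => u _; rewrite lee_fin.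
- exact: measurable_weight_integral.
- exact: measurable_weight_integral.
- move=> y _; apply: ge0_le_integral => //.
  + by move=> u _; rewrite lee_fin.
  + exact: measurable_section.
  + exact: measurable_section.
  + by move=> u _; rewrite lee_fin.
Qed.

Lemma two_step_integral_cst x (c : R) :
  two_step_integral x (fun=> c) = c%:E.
Proof.
rewrite /two_step_integral.
under eq_integral do rewrite (integral_cst (Q _) measurableT) prob_kernel mule1.
by rewrite (integral_cst (q x) measurableT) prob_kernel mule1.
Qed.

Lemma two_step_integral_fsum x (I : choiceType) (A : set I)
    (phi : I -> X * Y -> R) : finite_set A ->
  (forall i, measurable_fun [set: X * Y] (phi i)) ->
  (forall i z, (0 <= phi i z)%R) ->
  two_step_integral x (fun z => (\sum_(i \in A) phi i z)%R) =
  \sum_(i \in A) two_step_integral x (phi i).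
Proof.
move=> finA mphi phi0.
rewrite /two_step_integral -(ge0_integral_fsum (q x))//; first last.
- by move=> i y _; apply: integral_ge0 => u _; rewrite lee_fin.
- by move=> i; exact: measurable_weight_integral.
apply: eq_integral => y _; rewrite -(ge0_integral_fsum (Q y))//; first last.
- by move=> i u _; rewrite lee_fin.
- by move=> i; exact: measurable_section.
by apply: eq_integral => u _; rewrite fsumEFin.
Qed.

Lemma two_step_integralZl x (c : R) (phi : X * Y -> R) : (0 <= c)%R ->
  measurable_fun [set: X * Y] phi -> (forall z, (0 <= phi z)%R) ->
  two_step_integral x (fun z => (c * phi z)%R) = c%:E * two_step_integral x phi.
Proof.
move=> c0 mphi phi0.
rewrite /two_step_integral -ge0_integralZl_EFin//; first last.
- exact: measurable_weight_integral.
- by move=> y _; apply: integral_ge0 => u _; rewrite lee_fin.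
apply: eq_integral => y _; rewrite -ge0_integralZl_EFin//.
- by move=> u _; rewrite lee_fin.
- exact: measurable_section.
Qed.

(** One step of a chain that moves with density [a] and stays at [z] otherwise.
    On a simple function [h] below [f], writing [h] as a combination of
    indicators of its level sets turns the simple integral against [K] into
    [J (a h) + h z (1 - J a)], which is monotone in [h] because [J a <= 1]. *)
Lemma integral_accept_reject (z : X * Y) (a f : X * Y -> R)
    (K : set (X * Y) -> \bar R) :
  measurable_fun [set: X * Y] a -> measurable_fun [set: X * Y] f ->
  (forall t, (0 <= a t <= 1)%R) -> (forall t, (0 <= f t)%R) ->
  (forall A, measurable A ->
    K A = two_step_integral z.1 (fun t => (a t * \1_A t)%R)
          + \d_z A * (1 - two_step_integral z.1 a)) ->
  \int[K]_t (f t)%:E <=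
    two_step_integral z.1 (fun t => (a t * f t)%R)
    + (f z)%:E * (1 - two_step_integral z.1 a).
Proof.
move=> ma mf a01 f0 KE.
have a0 t : (0 <= a t)%R by case/andP: (a01 t).
have a1 t : (a t <= 1)%R by case/andP: (a01 t).
have Ja1 : two_step_integral z.1 a <= 1.
  by rewrite -(two_step_integral_cst z.1 1); apply: le_two_step_integral.
have rej0 : 0 <= 1 - two_step_integral z.1 a.
  by rewrite sube_ge0// fin_numElt (lt_le_trans (ltNyr 0)) ?two_step_integral_ge0//
    (le_lt_trans Ja1) ?ltry.
set rej := 1 - _ in KE rej0 *.
have K0 : K set0 = 0.
  rewrite KE// diracE in_set0 mul0e adde0.
  rewrite -[RHS](two_step_integral_cst z.1 0); congr two_step_integral.
  by apply/funext => t; rewrite indicE in_set0 mulr0.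
apply: ge0_integral_le_sintegral => // h hf.
have mh t : measurable (h @^-1` [set t]) by exact: measurable_funPTI.
have mterm t : measurable_fun [set: X * Y]
    (fun s => (a s * (t * \1_(h @^-1` [set t]) s))%R).
  apply: measurable_funM => //; apply: measurable_funM => //.
have ind0 t s : (0 <= t * \1_(h @^-1` [set t]) s :> R)%R.
  by rewrite -lee_fin EFinM nnfun_muleindic_ge0.
have -> : sintegral K h = two_step_integral z.1 (fun t => (a t * h t)%R)
    + (h z)%:E * rej.
  (* Off the range of h the level sets are empty, so the sum is finite. *)
  rewrite sintegralET -(fsbig_widen (range h) setT)//; last first.
    move=> t [_ /= ht]; rewrite (_ : _ @^-1` _ = set0) ?K0 ?mule0//.
    by apply/seteqP; split => // s /= hs; apply: ht; exists s.
  have -> : (fun t => a t * h t)%R = (fun s =>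
      \sum_(t \in range h) (a s * (t * \1_(h @^-1` [set t]) s)))%R.
    apply/funext => s; rewrite {1}(fimfunE h) fsbig_distrr//.
  rewrite two_step_integral_fsum//; last by move=> t s; rewrite mulr_ge0.
  rewrite (fimfunE h) -fsumEFin// ge0_mule_fsuml; last by move=> t; rewrite lee_fin.
  rewrite -fsbig_split//=; apply: eq_fsbigr => t /[1!inE] -[s _ <-].
  rewrite KE// ge0_muleDr; first last.
  - by rewrite mule_ge0// diracE lee_fin.
  - by apply: two_step_integral_ge0 => u; rewrite mulr_ge0// indicE.
  congr (_ + _)%E.
    pose psi u := (a u * \1_(h @^-1` [set h s]) u)%R.
    rewrite -(@two_step_integralZl z.1 (h s) psi).
    - by congr two_step_integral; apply/funext => u; rewrite mulrCA.
    - exact: fun_ge0.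
    - exact: measurable_funM.
    - by move=> u; rewrite mulr_ge0// indicE.
  by rewrite diracE indicE EFinM (muleA (h s)%:E).
apply: leeD.
  apply: le_two_step_integral.
  - exact: measurable_funM.
  - exact: measurable_funM.
  - move=> t; rewrite mulr_ge0//= ler_wpM2l//.
    by rewrite -lee_fin.
by apply: lee_wpmul2r => //.
Qed.

End two_step.

(** * Moment estimates on the weights *)

Lemma eq_integral_pos (R : realType) (mu : {measure set R -> \bar R})
    (f g : R -> R) :
  mu (~` `[0%R, +oo[) = 0 ->
  measurable_fun [set: R] f -> measurable_fun [set: R] g ->
  (forall u, (0 <= u)%R -> f u = g u) ->
  \int[mu]_u (f u)%:E = \int[mu]_u (g u)%:E.
Proof.
move=> mu0 mf mg fg; apply: ae_eq_integral => //; [exact/measurable_EFinP..|].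
exists (~` `[0%R, +oo[); split => //; first exact: measurableC.
move=> u /= /not_implyP[_ fgu] u0; apply: fgu.
by congr EFin; apply: fg; move: u0; rewrite in_itv/= andbT.
Qed.

Section drift_estimates.
Context (R : realType) (beta : R).

Local Notation V := (drift_fun beta).

Lemma drift_fun_gt0 (w : R) : (0 < V w)%R.
Proof. by rewrite /drift_fun ltr_wpDl// powR_ge0. Qed.

Lemma measurable_drift_fun : measurable_fun [set: R] V.
Proof. by apply: measurable_funD => //; exact: measurable_powR. Qed.

(** For [u <= w] the first summand alone equals [max 0 u]; for [u > w] one has
    [u <= u ^ beta / w ^ (beta - 1)]. Truncating at zero makes the bound valid on
    the whole real line. *)
Lemma ler_truncated_weight (u w : R) : (1 < beta)%R -> (0 < w)%R ->
  (Num.max 0 u <=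
   w * Num.min 1 (Num.max 0 u / w) + (w `^ (beta - 1))^-1 * V u)%R.
Proof.
move=> beta1 w0; have wb0 : (0 < w `^ (beta - 1))%R by exact: powR_gt0.
have rhs0 : (0 <= (w `^ (beta - 1))^-1 * V u)%R.
  by rewrite mulr_ge0 ?invr_ge0 ?ltW ?drift_fun_gt0.
have [uw|wu] := leP (Num.max 0 u)%R w.
  have -> : (Num.min 1 (Num.max 0 u / w) = Num.max 0 u / w)%R.
    by apply/min_idPr; rewrite ler_pdivrMr// mul1r.
  by rewrite mulrC divfK ?gt_eqF// lerDl.
have u0 : (0 < u)%R.
  by move: wu; rewrite lt_max [(w < 0)%R]lt_gtF//= => /(lt_trans w0).
rewrite (max_idPr (ltW u0)) in wu *.
rewrite ler_wpDl//; first by rewrite mulr_ge0 ?ltW// lt_min ltr01 divr_gt0.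
rewrite mulrC ler_pdivlMr// /drift_fun -(mulr_powRB1 (ltW u0)); last lra.
rewrite ler_wpDr//.
have b0 : (0 <= beta - 1)%R by lra.
by rewrite ler_wpM2l ?(ltW u0)// ge0_ler_powR// ?nnegrE ?ltW.
Qed.

(** Integrating [ler_truncated_weight] gives
    [1 <= w * I + M / w ^ (beta - 1)], with [I] the integral on the right-hand
    side, and the last term is at most 1/2. *)
Lemma integral_min_weight_ge (mu : {measure set R -> \bar R}) (M w : R) :
  (1 < beta)%R ->
  \int[mu]_u (Num.max 0%R u)%:E = 1 ->
  \int[mu]_u (V u)%:E <= M%:E ->
  (0 < w)%R -> (2 * M <= w `^ (beta - 1))%R ->
  ((2 * w)^-1)%:E <= \int[mu]_u (Num.min 1 (Num.max 0 u / w))%R%:E.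
Proof.
move=> beta1 mean1 momM w0 Mw.
set m := (fun u : R => (Num.min 1 (Num.max 0 u / w)))%R.
have wb0 : (0 < w `^ (beta - 1))%R by exact: powR_gt0.
have mmax : measurable_fun [set: R] (fun u : R => Num.max 0%R u).
  exact: measurable_maxr.
have mm : measurable_fun [set: R] m.
  by apply: measurable_minr => //; apply: measurable_funM.
have m0 u : (0 <= m u)%R.
  by rewrite le_min ler01 divr_ge0 ?(ltW w0)// le_max lexx.
have V0 u : (0 <= V u)%R by exact: ltW (drift_fun_gt0 u).
have mV := measurable_drift_fun.
have : 1 <= w%:E * \int[mu]_u (m u)%:E + ((w `^ (beta - 1))^-1)%:E * M%:E.
  apply: (@le_trans _ _ (w%:E * \int[mu]_u (m u)%:E
      + ((w `^ (beta - 1))^-1)%:E * \int[mu]_u (V u)%:E)); last first.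
    by rewrite leeD2l// lee_wpmul2l// lee_fin invr_ge0 ltW.
  rewrite -mean1 -!ge0_integralZl_EFin ?invr_ge0 ?(ltW w0) ?(ltW wb0)//;
    try by move=> u _; rewrite lee_fin.
  2: exact/measurable_EFinP.
  2: exact/measurable_EFinP.
  rewrite -ge0_integralD//=.
  - apply: ge0_le_integral => //.
    + by move=> u _; rewrite lee_fin le_max lexx.
    + exact/measurable_EFinP.
    + apply: emeasurable_funD; apply/measurable_EFinP => //.
      * exact: measurable_funM.
      * exact: measurable_funM.
    + by move=> u _; rewrite -!EFinM -EFinD lee_fin; exact: ler_truncated_weight.
  - by move=> u _; rewrite -EFinM lee_fin mulr_ge0// ltW.
  - by apply/measurable_EFinP; exact: measurable_funM.
  - by move=> u _; rewrite -EFinM lee_fin mulr_ge0// invr_ge0 ltW.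
  - by apply/measurable_EFinP; exact: measurable_funM.
have I0 : 0 <= \int[mu]_u (m u)%:E by apply: integral_ge0 => u _; rewrite lee_fin.
case: (\int[mu]_u (m u)%:E) I0 => [I| |] //=; last by move=> _ _; rewrite leey.
rewrite -!EFinM -EFinD !lee_fin => I0 h.
rewrite -[(_^-1)%R]mul1r ler_pdivrMr ?mulr_gt0//.
have : ((w `^ (beta - 1))^-1 * M <= 2^-1)%R.
  by rewrite mulrC ler_pdivrMr// ler_pdivlMl.
lra.
Qed.

(** In the next two lemmas [A] stands for the acceptance probability at [w] and
    [B] for the part of the expected drift coming from accepted moves. Below
    [wbar], it suffices that [V] is increasing. *)
Lemma drift_near (delta M A B w wbar : R) : (1 < beta)%R ->
  (0 <= delta)%R -> (0 <= A)%R -> (B <= M)%R -> (0 < w)%R -> (w <= wbar)%R ->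
  (B + V w * (1 - A) <= V w - delta * V w `^ ((beta - 1) / beta)
     + (M + delta * V wbar `^ ((beta - 1) / beta)))%R.
Proof.
move=> beta1 d0 A0 BM w0 ww.
have b0 : (0 < beta)%R by lra.
have Vw0 := drift_fun_gt0 w.
have Vle : (V w <= V wbar)%R.
  by rewrite lerD2r ge0_ler_powR ?nnegrE//; lra.
have : (V w `^ ((beta - 1) / beta) <= V wbar `^ ((beta - 1) / beta))%R.
  by rewrite ge0_ler_powR ?nnegrE ?divr_ge0 ?(ltW (drift_fun_gt0 _))//; lra.
move=> /(ler_wpM2l d0).
have : (0 <= V w * A)%R by rewrite mulr_ge0// ltW.
move: (V w) (V w `^ _)%R (V wbar `^ _)%R => v p p'.
by clear -BM; lra.
Qed.

(** With [t = w ^ (beta - 1)], acceptance lowers the drift by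
    [V w * A >= t * alpha / 2]. Half of this absorbs [B <= t * alpha / 4], and the
    other half dominates [delta * V w ^ ((beta - 1) / beta)], which is at most
    [alpha / 8 * (2 * t)]. *)
Lemma drift_far (alpha M A B w : R) : (1 < beta)%R ->
  (0 < alpha)%R -> (alpha / (2 * w) <= A)%R -> (B <= M)%R -> (1 <= w)%R ->
  (4 * M / alpha <= w `^ (beta - 1))%R ->
  (B + V w * (1 - A) <= V w - alpha / 8 * V w `^ ((beta - 1) / beta))%R.
Proof.
move=> beta1 a0 aA BM w1 Mw.
have w0 : (0 < w)%R by lra.
have b0 : (0 < beta)%R by lra.
set t := (w `^ (beta - 1))%R in Mw.
have t0 : (0 < t)%R by exact: powR_gt0.
have V2 : (V w `^ ((beta - 1) / beta) <= 2 * t)%R.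
  apply: (@le_trans _ _ ((2 * w `^ beta) `^ ((beta - 1) / beta))%R).
    rewrite ge0_ler_powR ?nnegrE ?divr_ge0 ?mulr_ge0 ?powR_ge0 ?(ltW (drift_fun_gt0 _))//;
      try lra.
    have : (1 <= w `^ beta)%R.
      by apply: (le_trans w1); apply: le1r_powR => //; lra.
    rewrite /drift_fun; lra.
  rewrite powRM ?powR_ge0// -powRrM mulrCA divff ?gt_eqF// mulr1.
  rewrite ler_pM2r// ler1_powR// ?ler_pdivrMr//; lra.
have VA : (t * (alpha / 2) <= V w * A)%R.
  apply: (@le_trans _ _ (w `^ beta * (alpha / (2 * w)))%R).
    rewrite -(mulr_powRB1 (ltW w0) b0) -/t le_eqVlt; apply/orP; left.
    by apply/eqP; field; lra.
  rewrite ler_pM ?powR_ge0// ?divr_ge0 ?lerDl//; lra.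
have : (alpha / 8 * V w `^ ((beta - 1) / beta) <= alpha / 8 * (2 * t))%R.
  by rewrite ler_pM2l// divr_gt0.
move: Mw; rewrite ler_pdivrMr//.
lra.
Qed.

End drift_estimates.

(** * The acceptance probability of the pseudo-marginal chain *)

Section pseudo_marginal_acceptance.
Context (d : measure_display) (X : measurableType d) (R : realType)
  (q : R.-pker X ~> X) (r : X * X -> R) (Q : R.-pker X ~> R).
Hypothesis mr : measurable_fun [set: X * X] r.
Hypothesis r_ge0 : forall z, (0 <= r z)%R.

(** A proposed weight is almost surely nonnegative; replacing it by its positive
    part makes the acceptance probability lie between 0 and 1 everywhere, so that the
    theory of nonnegative integrals applies. *)
Definition pos_accept (z z' : X * R) : R :=
  pm_accept r z (z'.1, Num.max 0 z'.2)%R.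

Lemma measurable_pm_accept z : measurable_fun [set: X * R] (pm_accept r z).
Proof.
apply: measurable_minr => //; apply: measurable_funM.
  apply: (measurableT_comp mr); apply: measurable_fun_pair => //.
by apply: measurable_funM => //; exact: measurable_snd.
Qed.

Lemma measurable_pos_accept z : measurable_fun [set: X * R] (pos_accept z).
Proof.
apply: (measurableT_comp (measurable_pm_accept z)).
apply: measurable_fun_pair => //; apply: measurable_maxr => //.
Qed.

Lemma pos_accept01 z z' : (0 < z.2)%R -> (0 <= pos_accept z z' <= 1)%R.
Proof.
move=> z0; rewrite /pos_accept /pm_accept ge_min lexx /= andbT le_min ler01/=.
by rewrite mulr_ge0// divr_ge0 ?le_max ?lexx// ltW.
Qed.

Lemma pm_kernelE (z : X * R) (A : set (X * R)) :
  (forall y, Q y (~` `[0%R, +oo[) = 0) -> measurable A ->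
  pm_kernel q r Q z A =
    two_step_integral q Q z.1 (fun t => (pos_accept z t * \1_A t)%R)
    + \d_z A * (1 - two_step_integral q Q z.1 (pos_accept z)).
Proof.
move=> Qneg mA.
have pos y u : (0 <= u)%R -> pm_accept r z (y, u) = pos_accept z (y, u).
  by move=> u0; rewrite /pos_accept/= (max_idPr u0).
have ma := measurable_pm_accept z; have mp := measurable_pos_accept z.
have mI : measurable_fun [set: X * R] (\1_A : X * R -> R).
  exact: measurable_indic.
have msec (phi : X * R -> R) y : measurable_fun [set: X * R] phi ->
    measurable_fun [set: R] (fun u => phi (y, u)).
  by move=> mphi; exact: (measurableT_comp mphi (pair1_measurable y)).
have accA y : \int[Q y]_u (pm_accept r z (y, u) * \1_A (y, u))%:E =
    \int[Q y]_u (pos_accept z (y, u) * \1_A (y, u))%:E.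
  apply: (@eq_integral_pos R (Q y)
    (fun u => (pm_accept r z (y, u) * \1_A (y, u))%R)
    (fun u => (pos_accept z (y, u) * \1_A (y, u))%R) (Qneg y)).
  - exact: (msec _ y (measurable_funM ma mI)).
  - exact: (msec _ y (measurable_funM mp mI)).
  - by move=> u u0; rewrite pos.
have acc y : \int[Q y]_u (pm_accept r z (y, u))%:E =
    \int[Q y]_u (pos_accept z (y, u))%:E.
  apply: (@eq_integral_pos R (Q y) (fun u => pm_accept r z (y, u))
    (fun u => pos_accept z (y, u)) (Qneg y)).
  - exact: (msec _ y ma).
  - exact: (msec _ y mp).
  - by move=> u u0; rewrite pos.
by rewrite /pm_kernel /pm_rejection /two_step_integral
  (eq_integral _ _ (fun y _ => accA y)) (eq_integral _ _ (fun y _ => acc y)).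
Qed.

(** [min 1 (s t) >= min 1 s * min 1 t] for nonnegative [s] and [t], and the
    right-hand side integrates in [u] first. *)
Lemma two_step_accept_ge (x : X) (w c : R) : (0 < w)%R -> (0 <= c)%R ->
  (forall y, c%:E <= \int[Q y]_u (Num.min 1 (Num.max 0 u / w))%R%:E) ->
  mh_acceptance q r x * c%:E <= two_step_integral q Q x (pos_accept (x, w)).
Proof.
move=> w0 c0 Qc.
pose s (y : X) := (Num.min 1 (r (x, y)))%R.
pose m (u : R) := (Num.min 1 (Num.max 0 u / w))%R.
have s0 y : (0 <= s y)%R by rewrite le_min ler01 r_ge0.
have ratio0 u : (0 <= Num.max 0 u / w)%R.
  by rewrite divr_ge0 ?(ltW w0)// le_max lexx.
have m0 u : (0 <= m u)%R by rewrite le_min ler01 ratio0.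
have ms : measurable_fun [set: X] s.
  by apply: measurable_minr => //; apply: (measurableT_comp mr).
have mm : measurable_fun [set: R] m.
  by apply: measurable_minr => //; apply: measurable_funM => //;
    exact: measurable_maxr.
have sm0 (t : X * R) : (0 <= s t.1 * m t.2)%R by rewrite mulr_ge0.
have msm : measurable_fun [set: X * R] (fun t => s t.1 * m t.2)%R.
  by apply: measurable_funM; apply: measurableT_comp => //.
apply: (@le_trans _ _ (two_step_integral q Q x (fun t => s t.1 * m t.2)%R)).
  have -> : mh_acceptance q r x = \int[q x]_y (s y)%:E by [].
  rewrite muleC -ge0_integralZl_EFin//;
    [|by move=> y _; rewrite lee_fin|exact/measurable_EFinP].
  apply: ge0_le_integral => //.
  - by move=> y _; rewrite -EFinM lee_fin mulr_ge0.
  - by apply/measurable_EFinP; exact: measurable_funM.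
  - exact: (measurable_weight_integral Q sm0 msm).
  - move=> y _; rewrite muleC.
    have -> : \int[Q y]_u (s y * m u)%:E = (s y)%:E * \int[Q y]_u (m u)%:E.
      rewrite -ge0_integralZl_EFin//; last exact/measurable_EFinP.
      by move=> u _; rewrite lee_fin.
    by rewrite lee_wpmul2l// ?lee_fin// Qc.
have mp := measurable_pos_accept (x, w).
apply: (le_two_step_integral q Q x msm mp) => -[y u].
rewrite mulr_ge0//= /pos_accept /pm_accept/=.
rewrite le_min; apply/andP; split.
  by rewrite mulr_ile1// ge_min lexx.
by apply: ler_pM => //; rewrite /s /m ge_min lexx orbT.
Qed.

End pseudo_marginal_acceptance.

Lemma mh_ratio_ge0 (d : measure_display) (X : measurableType d) (R : realType)
    (pi : probability X R) (q : R.-pker X ~> X) (r : X * X -> R) :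
  mh_ratio pi q r -> forall z, (0 <= r z)%R.
Proof.
move=> [_ [S [mS [_ _ _ _ [rS rNS]]]]] [x y].
have [/rS[/ltW//]|/rNS->//] := pselect (S (x, y)).
Qed.

(** * The drift condition *)

Unset Implicit Arguments.

Theorem corollary31 (d : measure_display) (X : measurableType d) (R : realType)
    (pi : probability X R) (q : R.-pker X ~> X)
    (r : X * X -> R) (r_ratio : mh_ratio pi q r)
    (W : set R) (mW : measurable W) (W_ge0 : W `<=` `[0%R, +oo[)
    (Q : R.-pker X ~> R) (Q_W : forall x, Q x W = 1)
    (Q_mean : forall x, \int[Q x]_w w%:E = 1)
    (alpha0_gt0 : 0 < ereal_inf [set mh_acceptance q r x | x in [set: X]])
    (beta : R) (beta_gt1 : (1 < beta)%R)
    (MW_fin : weight_moment_bound beta Q < +oo) :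
  exists delta wbar : R,
    [/\ (0 < delta)%R, (1 < wbar)%R &
      let V := drift_fun beta in
      let bV : R := (fine (weight_moment_bound beta Q)
                     + delta * V wbar `^ ((beta - 1) / beta))%R in
      forall (x : X) (w : R), W w -> (0 < w)%R ->
        \int[pm_kernel q r Q (x, w)]_z (V z.2)%:E
        <= (V w - delta * V w `^ ((beta - 1) / beta)
            + bV * \1_(`]0%R, wbar[) w)%R%:E].
Proof.
have [mr _] := r_ratio.
have r0 := mh_ratio_ge0 r_ratio.
set M := fine (weight_moment_bound beta Q).
have [alpha [a0 a_acc]] : exists alpha : R, (0 < alpha)%R /\
    forall x, alpha%:E <= mh_acceptance q r x.
  have acc x : ereal_inf [set mh_acceptance q r x | x in [set: X]]
      <= mh_acceptance q r x by apply: ereal_inf_lbound; exists x.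
  case: ereal_inf alpha0_gt0 acc => [a|_|//].
    by rewrite lte_fin => a0 acc; exists a.
  (* The infimum is infinite when X is empty. *)
  by move=> acc; exists 1%R; split => // x; apply: (le_trans _ (acc x)); exact: leey.
(* t0 is the value of wbar ^ (beta - 1). Its summands ensure, in turn, that
   wbar > 1, that integral_min_weight_ge applies above wbar, and that drift_far
   does. With the absolute value of M, no sign of M has to be established. *)
pose t0 := (2 + 2 * `|M| + 4 * `|M| / alpha)%R.
have MM : (M <= `|M|)%R := ler_norm M.
have M0 : (0 <= `|M|)%R := normr_ge0 M.
have Ma0 : (0 <= 4 * `|M| / alpha)%R.
  by rewrite divr_ge0 ?mulr_ge0// ltW.
have b0 : (0 < beta - 1)%R by lra.
pose wbar := (t0 `^ (beta - 1)^-1)%R.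
have wbarE : (wbar `^ (beta - 1) = t0)%R.
  rewrite /wbar -powRrM mulVf ?gt_eqF// powRr1// /t0; lra.
have wbar1 : (1 < wbar)%R.
  rewrite ltNge; apply/negP => wbar1.
  have : (wbar `^ (beta - 1) <= 1 `^ (beta - 1))%R.
    by rewrite ge0_ler_powR ?nnegrE ?powR_ge0// ltW.
  rewrite wbarE powR1 /t0; lra.
exists (alpha / 8)%R, wbar; split => //; first by rewrite divr_gt0.
move=> V bV x w Ww w0.
have mV : measurable_fun [set: R] V by exact: measurable_drift_fun.
have V0 u : (0 <= V u)%R by exact: ltW (drift_fun_gt0 _ _).
have momE y : \int[Q y]_u (V u)%:E <= M%:E.
  have Qy_le : \int[Q y]_u (V u)%:E <= weight_moment_bound beta Q.
    by apply: ereal_sup_ubound; exists y.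
  have Qy0 : 0 <= \int[Q y]_u (V u)%:E.
    by apply: integral_ge0 => u _; rewrite lee_fin.
  by rewrite fineK// ge0_fin_numE// (le_trans Qy0).
have Qneg y : Q y (~` `[0%R, +oo[) = 0.
  have QW0 : Q y (~` W) = 0.
    have : Q y [set: R] = Q y W + Q y (~` W).
      by rewrite -(setUCr W) measureU ?setICr//; exact: measurableC.
    rewrite prob_kernel Q_W; case: (Q y (~` W)) => //= s.
    by rewrite -EFinD => -[h]; have -> : s = 0%R by lra.
  apply: (subset_measure0 (B := ~` W)) => //.
  - exact: measurableC.
  - exact: measurableC.
  - exact: subsetC.
have mean1 y : \int[Q y]_u (Num.max 0%R u)%:E = 1.
  rewrite -(Q_mean y).
  apply: (@eq_integral_pos R (Q y) (Num.max 0%R) id (Qneg y)) => //.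
  - exact: measurable_maxr.
  - by move=> u u0; rewrite (max_idPr u0).
set a := pos_accept r (x, w).
have ma : measurable_fun [set: X * R] a by exact: measurable_pos_accept.
have a01 t : (0 <= a t <= 1)%R by exact: pos_accept01.
have mV2 : measurable_fun [set: X * R] (fun t => V t.2).
  by apply: measurableT_comp => //.
have KE A (mA : measurable A) := pm_kernelE q mr (x, w) Qneg mA.
apply: (le_trans (integral_accept_reject ma mV2 a01 (fun t => V0 t.2) KE)).
rewrite [(x, w).1]/= [(x, w).2]/=.
have a_ge0 t : (0 <= a t)%R by case/andP: (a01 t).
have JA0 : 0 <= two_step_integral q Q x a by exact: two_step_integral_ge0.
have JA1 : two_step_integral q Q x a <= 1.
  by rewrite -(two_step_integral_cst q Q x 1); exact: le_two_step_integral.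
have JB0 : 0 <= two_step_integral q Q x (fun t => a t * V t.2)%R.
  by apply: two_step_integral_ge0 => t; rewrite mulr_ge0.
have JBM : two_step_integral q Q x (fun t => a t * V t.2)%R <= M%:E.
  apply: (@le_trans _ _ (two_step_integral q Q x (fun t => V t.2))).
    apply: le_two_step_integral => //; first exact: measurable_funM.
    move=> t; rewrite mulr_ge0//= ler_piMl//.
    by case/andP: (a01 t).
  apply: (@le_trans _ _ (\int[q x]_y cst M%:E y)).
    apply: ge0_le_integral => //.
    - by move=> y _; apply: integral_ge0 => u _; rewrite lee_fin.
    - exact: (measurable_weight_integral Q (fun t => V0 t.2) mV2).
  by rewrite integral_cst// prob_kernel mule1.
have JAw : (2 * M <= w `^ (beta - 1))%R ->
    (alpha / (2 * w))%:E <= two_step_integral q Q x a.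
  move=> Mw.
  have c0 : (0 <= (2 * w)^-1)%R by rewrite invr_ge0 mulr_ge0// ltW.
  apply: le_trans; last first.
    apply: (two_step_accept_ge q mr r0 x w0 c0) => // y.
    exact: (integral_min_weight_ge beta_gt1).
  by rewrite EFinM lee_wpmul2r.
move: JA0 JA1 JAw; case: (two_step_integral q Q x a) => // A.
move: JB0 JBM; case: (two_step_integral q Q x (fun t => a t * V t.2)%R) => // B.
rewrite !lee_fin => B0 BM A0 A1 Aw.
have [ww|ww] := ltP w wbar.
  rewrite indicE mem_set ?mulr1; last by rewrite /= in_itv/= w0.
  by apply: drift_near => //; rewrite ?divr_ge0 ?ltW.
rewrite indicE memNset ?mulr0 ?addr0; last first.
  by rewrite /= in_itv/= w0/= ltNge ww.
have tw : (t0 <= w `^ (beta - 1))%R.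
  by rewrite -wbarE ge0_ler_powR ?nnegrE ?powR_ge0// ltW.
have Ma : (4 * M / alpha <= 4 * `|M| / alpha)%R.
  by rewrite ler_pM2r ?invr_gt0//; lra.
rewrite /t0 in tw.
apply: (drift_far (M := M)) => //.
- by apply: Aw; lra.
- lra.
- by apply: (le_trans Ma); apply: le_trans tw; rewrite lerDr; lra.
Qed.
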